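(* Let $M$ be a Riemannian manifold (possibly infinite-dimensional). If $f:M\to(-\infty,\infty]$ is lower semicontinuous and proper then $\{p\in\mathrm{dom}(f) : D^{-}f(p)\neq\emptyset\}$ is dense in $\mathrm{dom}(f):=\{x\in M : f(x)<\infty\}$.
   Context: A Riemannian manifold is a $C^\infty$ manifold modelled on a Hilbert space (possibly infinite-dimensional) with a $C^\infty$ assignment of scalar products on the tangent spaces inducing equivalent norms. Proper means not identically $+\infty$. For $p\in\mathrm{dom}(f)$, the subdifferential $D^{-}f(p)\subset T^*M_p$ is the set of all $d\varphi(p)$ with $\varphi\in C^1(M,\mathbb{R})$ such that $f-\varphi$ attains a local minimum at $p$. *)

(* Defs.v *)
From HB Require Import structures.
From mathcomp Require Import all_boot all_order all_algebra.
From mathcomp Require Import sesquilinear.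
From mathcomp Require Import all_classical all_reals all_analysis.

Set Implicit Arguments.
Unset Strict Implicit.
Unset Printing Implicit Defensive.

Import Order.TTheory GRing.Theory Num.Theory.
Import numFieldNormedType.Exports.

Local Open Scope classical_set_scope.
Local Open Scope ring_scope.

(* The space L(E, F) of continuous linear maps with the operator norm. *)
Section BoundedLinearMaps.
Context {R : realType} (E F : normedModType R).

Definition blin_pred : {pred E -> F} := fun f => `[< linear f /\ continuous f >].

Record blin := Blin { blin_fun :> E -> F ; _ : blin_fun \in blin_pred }.

HB.instance Definition _ := [isSub for blin_fun].
HB.instance Definition _ := [Choice of blin by <:].

Lemma blin_submod_closed : submod_closed blin_pred.
Proof.
split=> [|a f g /asboolP[lf cf] /asboolP[lg cg]]; apply/asboolP.
  by split=> [a u v|]; [rewrite scaler0 addr0|exact: cst_continuous].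
split=> [b u v|x].
  change (a *: f (b *: u + v) + g (b *: u + v) =
          b *: (a *: f u + g u) + (a *: f v + g v)).
  by rewrite lf lg !scalerDr !scalerA (mulrC a b) addrACA.
by apply: cvgD; [apply: cvgZl_tmp; exact: cf|exact: cg].
Qed.

HB.instance Definition _ :=
  GRing.isSubmodClosed.Build R (E -> F) blin_pred blin_submod_closed.
HB.instance Definition _ := [SubChoice_isSubLmodule of blin by <:].

Lemma blin_linear (f : blin) : linear f.
Proof. by case: f => f /= /asboolP[]. Qed.

Lemma blin_continuous (f : blin) : continuous f.
Proof. by case: f => f /= /asboolP[]. Qed.

HB.instance Definition _ (f : blin) :=
  GRing.isLinear.Build R E F *:%R (blin_fun f) (blin_linear f).

Definition blin_norm (f : blin) : R :=
  sup [set `|f x| | x in [set x : E | `|x| <= 1]].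

Lemma blin_norm_has_sup (f : blin) :
  has_sup [set `|f x| | x in [set x : E | `|x| <= 1]].
Proof.
split; first by exists `|f 0|, 0 => //=; rewrite normr0.
have /linear_bounded_continuous/bounded_funP/(_ 1)[M fM] :=
  @blin_continuous f.
by exists M => _ [x /= x1 <-]; exact: fM.
Qed.

Lemma blin_norm_ub (f : blin) x : `|x| <= 1 -> `|f x| <= blin_norm f.
Proof.
by move=> x1; apply: (sup_upper_bound (blin_norm_has_sup f)); exists x.
Qed.

Lemma blin_norm_le (f : blin) (c : R) :
  (forall x, `|x| <= 1 -> `|f x| <= c) -> blin_norm f <= c.
Proof.
move=> fc; apply: ge_sup; first by case: (blin_norm_has_sup f).
by move=> _ [x /= x1 <-]; exact: fc.
Qed.

Lemma blin_ler_normD (f g : blin) :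
  blin_norm (f + g) <= blin_norm f + blin_norm g.
Proof.
apply: blin_norm_le => x x1; apply: (le_trans (ler_normD (f x) (g x))).
by rewrite lerD// blin_norm_ub.
Qed.

Lemma blin_normrZ (a : R) (f : blin) :
  blin_norm (a *: f) = `|a| * blin_norm f.
Proof.
have Zle (b : R) (h : blin) : blin_norm (b *: h) <= `|b| * blin_norm h.
  apply: blin_norm_le => x x1.
  by rewrite (normrZ b (h x)) ler_wpM2l// blin_norm_ub.
apply/eqP; rewrite eq_le Zle /=.
have [->|a0] := eqVneq a 0.
  rewrite normr0 mul0r; apply: le_trans (blin_norm_ub _ (_ : `|0| <= 1)) => //.
  by rewrite normr0.
rewrite -ler_pdivlMl ?normr_gt0// -normfV.
by rewrite -{1}[f](scalerK a0) Zle.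
Qed.

Lemma blin_normr0_eq0 (f : blin) : blin_norm f = 0 -> f = 0.
Proof.
move=> f0; apply: val_inj; apply/funext => x /=.
have [->|x0] := eqVneq x 0; first by rewrite linear0.
have /(blin_norm_ub f) : `| `|x|^-1 *: x| <= 1.
  by rewrite normrZ normfV normr_id mulVf// normr_eq0.
rewrite f0 linearZ normrZ normfV normr_id.
rewrite ler_pdivrMl ?normr_gt0// mulr0 normr_le0.
by move/eqP.
Qed.

HB.instance Definition _ :=
  Lmodule_isNormed.Build R blin blin_ler_normD blin_normrZ blin_normr0_eq0.

End BoundedLinearMaps.

(* The Fréchet derivative E -> L(E, F), with value 0 where f is not
   differentiable. *)
Section FrechetDerivative.
Context {R : realType} {E F : normedModType R}.

Lemma diff_blin_pred (f : E -> F) x :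
  differentiable f x -> ('d f x : E -> F) \in @blin_pred R E F.
Proof.
move=> df; apply/asboolP; split; first exact: linearP.
exact: diff_continuous.
Qed.

Definition fderive (f : E -> F) (x : E) : blin E F :=
  if pselect (differentiable f x) is left df then Blin (diff_blin_pred df)
  else 0.

End FrechetDerivative.

(* [Ck k U f]: f is of class C^k on the open set U. *)
Fixpoint Ck {R : realType} {E : normedModType R} (k : nat)
    {F : normedModType R} (U : set E) (f : E -> F) : Prop :=
  if k is k'.+1 then
    (forall x, U x -> differentiable f x) /\ Ck k' U (fderive f)
  else forall x, U x -> {for x, continuous f}.

Definition Cinfty {R : realType} {E F : normedModType R}
  (U : set E) (f : E -> F) : Prop := forall k, Ck k U f.

(* A C^oo atlas on M modelled on E.  The maps [chart i] and [chart_inv i] are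
   total; only their values on [chart_dom i] and on its image matter. *)
Record atlas (R : realType) (E : normedModType R) (M : topologicalType) :=
  Atlas {
  chart_index : Type ;
  chart_dom : chart_index -> set M ;
  chart : chart_index -> M -> E ;
  chart_inv : chart_index -> E -> M ;
  chart_dom_open : forall i, open (chart_dom i) ;
  chart_cover : forall p, exists i, chart_dom i p ;
  chart_img_open : forall i, open (chart i @` chart_dom i) ;
  chartK : forall i p, chart_dom i p -> chart_inv i (chart i p) = p ;
  chart_continuous : forall i, {within chart_dom i, continuous (chart i)} ;
  chart_inv_continuous :
    forall i, {within chart i @` chart_dom i, continuous (chart_inv i)} ;
  transition_Cinfty : forall i j,
    Cinfty (chart i @` (chart_dom i `&` chart_dom j))
           (chart j \o chart_inv i)
}.

Section Tangent.
Context {R : realType} {E : normedModType R} {M : topologicalType}.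
Variable A : atlas E M.
Local Notation I := (chart_index A).

Definition chart_img (i : I) : set E := chart i @` chart_dom i.

(* A tangent vector at p, i.e. an equivalence class of pairs (i, v) with i a
   chart at p and v in E, for (i, v) ~ (j, w) iff w = D(x_j o x_i^-1)(x_i p) v,
   is encoded as the function whose graph is that class (extended by 0 to the
   charts whose domain does not contain p). *)
Definition tangent_pred (p : M) : {pred I -> E} := fun X =>
  `[< (forall i, ~ chart_dom i p -> X i = 0) /\
      (forall i j, chart_dom i p -> chart_dom j p ->
         X j = 'd (chart j \o chart_inv i) (chart i p) (X i)) >].

Record tangent (p : M) :=
  Tangent { coord :> I -> E ; _ : coord \in tangent_pred p }.

HB.instance Definition _ (p : M) := [isSub for @coord p].
HB.instance Definition _ (p : M) := [Choice of tangent p by <:].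

Lemma tangent_submod_closed (p : M) : submod_closed (tangent_pred p).
Proof.
split=> [|a X Y /asboolP[X0 XE] /asboolP[Y0 YE]]; apply/asboolP.
  by split=> // i j _ _; rewrite linear0.
split=> [i ip|i j ip jp].
  change (a *: X i + Y i = 0).
  by rewrite X0// Y0// scaler0 addr0.
change (a *: X j + Y j =
  'd (chart j \o chart_inv i) (chart i p) (a *: X i + Y i)).
by rewrite linearP -XE// -YE.
Qed.

HB.instance Definition _ (p : M) := GRing.isSubmodClosed.Build R (I -> E)
  (tangent_pred p) (tangent_submod_closed p).
HB.instance Definition _ (p : M) := [SubChoice_isSubLmodule of tangent p by <:].

(* The continuous linear functionals on the tangent space, whose topology is
   the one read in any chart at p. *)
Record cotangent (p : M) := Cotangent {
  covector :> {scalar tangent p} ;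
  covector_bounded : forall i, chart_dom i p ->
    exists C : R, forall X : tangent p, `|covector X| <= C * `|X i|
}.

Definition C1 (phi : M -> R) : Prop :=
  forall i : I, Ck 1 (chart_img i) (phi \o chart_inv i).

(* [xi] is the differential of [phi] at [p]; its expression in one chart at p
   determines it. *)
Definition is_mdiff (phi : M -> R) (p : M) (xi : cotangent p) : Prop :=
  forall i, chart_dom i p ->
    forall X : tangent p, xi X = 'd (phi \o chart_inv i) (chart i p) (X i).

Definition local_min (h : M -> \bar R) (p : M) : Prop :=
  \forall x \near p, (h p <= h x)%E.

Definition subdifferential (f : M -> \bar R) (p : M) : set (cotangent p) :=
  [set xi | exists phi : M -> R,
     [/\ C1 phi, local_min (fun x => f x - (phi x)%:E)%E p
       & is_mdiff phi xi]].

Record riemannian_metric := RiemannianMetric {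
  metric :> forall p : M, {dot (tangent p) for idfun} ;
  metric_equiv : forall p i, chart_dom i p ->
    exists c C : R, [/\ 0 < c, 0 < C & forall X : tangent p,
      c * `|X i| <= Num.sqrt (metric p X X) <= C * `|X i|] ;
  metric_Cinfty : forall i : I, exists2 G : E -> blin E (blin E R),
    Cinfty (chart_img i) G &
    forall p, chart_dom i p -> forall X Y : tangent p,
      metric p X Y = G (chart i p) (X i) (Y i)
}.

End Tangent.

Arguments subdifferential {R E M} A f p.

Definition edom {T : Type} {R : realType} (f : T -> \bar R) : set T :=
  [set x | (f x < +oo)%E].

(* Main.v *)
Require Import Defs.
From HB Require Import structures.
From mathcomp Require Import all_boot all_order all_algebra.
From mathcomp Require Import sesquilinear.
From mathcomp Require Import all_classical all_reals all_analysis.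
From mathcomp Require Import ring lra.
Import Order.TTheory GRing.Theory Num.Theory.
Import numFieldNormedType.Exports.
Local Open Scope classical_set_scope.
Local Open Scope ring_scope.

(** Let p0 be in the domain of f and W a neighbourhood of p0.  Read f in a chart
    i at p0, on a closed ball around the image x0 of p0 that is mapped into W
    and on which f > f p0 - 1.

    The variational principle of Borwein and Preiss perturbs the lower
    semicontinuous function h = f o chart_inv i by a series of squared distances
    so that a minimum is attained at a point x well inside the ball
    (quadratic_variational_principle).  In a Hilbert space such a series is a
    single quadratic function, so at x the function h has a lower contact with
    a paraboloid: h y - h x >= (v, y - x) - c |y - x|^2 for a vector v.

    The definition of the subdifferential asks for a test function of class C1
    on the whole of M.  It is obtained by replacing the paraboloid by a bump of
    small support with gradient v at x which lies below it near x
    (radial_bump_peak), and by extending this bump by zero outside of the chart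
    (C1_extend_by_zero).  The extension is C1 only if the image in M of a small
    closed ball of the chart does not accumulate at a point q outside of the
    chart domain.  Closed balls are not compact in infinite dimension, so this
    does not follow from M being Hausdorff; it is where the Riemannian metric is
    used (chart_ball_separated).  The metric makes the transition maps Lipschitz
    with a constant that is uniform near p0 and near q: a short segment ending
    at q, read in a chart at q, has a short image in the chart i, which thus
    cannot leave a ball twice as large; by completeness and Hausdorffness the
    segment then remains in the domain of i up to its end q, a contradiction. *)

(** * Inner products *)

Section InnerProduct.
Context {R : realType} {E : normedModType R} {dotE : {dot E for idfun}}.
Hypothesis E_hilbert : forall v : E, `|v| = Num.sqrt (dotE v v).

Lemma dotC u v : dotE u v = dotE v u.
Proof. by rewrite hermC /= expr0 mul1r. Qed.

Lemma dotZr a u v : dotE u (a *: v) = a * dotE u v.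
Proof. exact: linearZr_LR. Qed.

Lemma dotZl a u v : dotE (a *: u) v = a * dotE u v.
Proof. by rewrite dotC dotZr dotC. Qed.

Lemma dotDr u v w : dotE u (v + w) = dotE u v + dotE u w.
Proof. exact: linearDr. Qed.

Lemma dotDl u v w : dotE (u + v) w = dotE u w + dotE v w.
Proof. by rewrite dotC dotDr !(dotC w). Qed.

Lemma dotBr u v w : dotE u (v - w) = dotE u v - dotE u w.
Proof. exact: linearBr. Qed.

Lemma dotBl u v w : dotE (u - v) w = dotE u w - dotE v w.
Proof. by rewrite dotC dotBr !(dotC w). Qed.

Lemma dot_norm v : dotE v v = `|v| ^+ 2.
Proof.
rewrite E_hilbert sqr_sqrtr//.
have [->|/neq0_dnorm_gt0/ltW//] := eqVneq v 0.
by rewrite linear0r.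
Qed.

Lemma normD_sqr u v : `|u + v| ^+ 2 = `|u| ^+ 2 + 2 * dotE u v + `|v| ^+ 2.
Proof.
rewrite -!dot_norm linearDl /= !linearDr /= (dotC v u); ring.
Qed.

Lemma normB_sqr u v : `|u - v| ^+ 2 = `|u| ^+ 2 - 2 * dotE u v + `|v| ^+ 2.
Proof. by rewrite normD_sqr linearNr normrN mulrN. Qed.

(** Obtained by expanding the two squares |v| u - |u| v and |v| u + |u| v. *)
Lemma cauchy_schwarz u v : `|dotE u v| <= `|u| * `|v|.
Proof.
have [->|u0] := eqVneq u 0; first by rewrite linear0l !normr0 mul0r.
have [->|v0] := eqVneq v 0; first by rewrite linear0r !normr0 mulr0.
have up : 0 < `|u| by rewrite normr_gt0.
have vp : 0 < `|v| by rewrite normr_gt0.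
have uv : 0 < `|u| * `|v| by rewrite mulr_gt0.
have := sqr_ge0 `| `|v| *: u + `|u| *: v|.
have := sqr_ge0 `| `|v| *: u - `|u| *: v|.
rewrite normB_sqr normD_sqr !normrZ !normr_id dotZl dotZr.
move: (dotE u v) => d H1 H2.
have {}H1 : 0 <= (`|u| * `|v|) * (`|u| * `|v| - d) by move: H1; lra.
have {}H2 : 0 <= (`|u| * `|v|) * (`|u| * `|v| + d) by move: H2; lra.
by move: H1 H2; rewrite !pmulr_rge0// subr_ge0 ler_norml; lra.
Qed.

Lemma dot_cvgr {T : Type} {F : set_system T} {FF : Filter F} (y : E)
  (f : T -> E) (l : E) : f @ F --> l -> dotE y (f t) @[t --> F] --> dotE y l.
Proof.
move=> fl; apply/cvgrPdist_le => e e0.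
have d0 : 0 < e / (`|y| + 1) by rewrite divr_gt0// ltr_wpDl.
move/cvgrPdist_le: fl => /(_ _ d0); apply: filterS => t lt.
rewrite -dotBr; apply: le_trans (cauchy_schwarz _ _) _.
have := normr_ge0 y; move: lt; rewrite ler_pdivlMr ?ltr_wpDl//.
have := normr_ge0 (l - f t); nra.
Qed.

End InnerProduct.

(** * Frechet differentiability and maps of class C1 *)

Section Differentiability.
Context {R : realType} {E F : normedModType R}.

Lemma is_diff_epsP (f : E -> F) (x : E) (L : {linear E -> F}) :
  continuous L ->
  (forall e, 0 < e ->
    \forall h \near 0, `|f (x + h) - f x - L h| <= e * `|h|) ->
  is_diff x f L.
Proof.
move=> cL fL.
have fE : f \o shift x = cst (f x) + L +o_ 0 id.
  apply/eqaddoP => e e0; near=> h.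
  rewrite /= !fctE/= opprD addrA (addrC h).
  by near: h; exact: fL.
have dL := diff_unique cL fE.
by apply: DiffDef => //; apply/diff_locallyP; rewrite dL.
Unshelve. all: by end_near. Qed.

Lemma differentiable_eps (f : E -> F) (x : E) : differentiable f x ->
  forall e, 0 < e ->
    \forall h \near 0, `|f (x + h) - f x - 'd f x h| <= e * `|h|.
Proof.
move=> /diff_locally/eqaddoP fd e e0; have := fd _ e0.
by apply: filterS => h; rewrite /= !fctE/= opprD addrA (addrC h).
Qed.

(** The differentials of explicit functions are obtained from this criterion:
    a remainder bounded by a multiple of |h|^2 is negligible with respect to
    |h|. *)
Lemma is_diff_quadratic (f : E -> F) (x : E) (L : {linear E -> F}) (K : R) :
  continuous L ->
  (forall h, `|h| <= 1 -> `|f (x + h) - f x - L h| <= K * `|h| ^+ 2) ->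
  is_diff x f L.
Proof.
move=> cL fL; apply: is_diff_epsP => // e e0; near=> h.
apply: le_trans (fL h _) _.
  by near: h; apply: nbhs0_le.
rewrite expr2 mulrA ler_wpM2r//.
apply: (@le_trans _ _ ((`|K| + 1) * `|h|)).
  by rewrite ler_wpM2r// ler_wpDr// ler_norm.
rewrite mulrC -ler_pdivlMr ?ltr_wpDl//.
near: h; apply: nbhs0_le.
by rewrite divr_gt0// ltr_wpDl.
Unshelve. all: by end_near. Qed.

Lemma near_eq_is_diff (f g : E -> F) (x : E) :
  (\forall y \near x, f y = g y) -> differentiable f x -> is_diff x g ('d f x).
Proof.
move=> fg df; apply: is_diff_epsP; first exact: diff_continuous.
move=> e e0; have := differentiable_eps f x df e e0.
have : \forall h \near 0, f (x + h) = g (x + h).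
  by move: fg; rewrite (near_shift 0 x); apply: filterS => h /=;
    rewrite subr0 addrC.
by apply: filterS2 => h <-; rewrite (nbhs_singleton fg).
Qed.

Lemma fderiveE (f : E -> F) x :
  differentiable f x -> fderive f x = 'd f x :> (E -> F).
Proof. by rewrite /fderive; case: pselect. Qed.

Lemma near_eq_differentiable (f g : E -> F) (x : E) :
  (\forall y \near x, f y = g y) -> differentiable f x -> differentiable g x.
Proof. by move=> fg /(near_eq_is_diff _ _ _ fg) []. Qed.

Lemma near_eq_fderive (f g : E -> F) (x : E) :
  (\forall y \near x, f y = g y) -> differentiable f x ->
  fderive f x = fderive g x.
Proof.
move=> fg df; have [dg dgE] := near_eq_is_diff _ _ _ fg df.
by apply: val_inj; apply/funext => v /=; rewrite !fderiveE// dgE.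
Qed.

(** Being of class C1 is a local property.  The functions on the manifold
    are defined by cases, and this reduces their regularity to that of each
    case on a neighbourhood of each point. *)
Lemma Ck1_near_eq (U : set E) (f : E -> F) :
  (forall x, U x -> exists V g, [/\ open V, V x, Ck 1 V g &
     forall y, V y -> g y = f y]) -> Ck 1 U f.
Proof.
move=> fU.
have geq V g x : open V -> V x -> (forall y, V y -> g y = f y) ->
    \forall y \near x, g y = f y.
  move=> oV Vx gf; have : nbhs x V by exact: open_nbhs_nbhs.
  by apply: filterS => y; exact: gf.
split=> x Ux; have [V [g [oV Vx [dg cg] gf]]] := fU _ Ux.
  exact: near_eq_differentiable (geq _ _ _ oV Vx gf) (dg _ Vx).
have eqfd y : V y -> fderive g y = fderive f y.
  by move=> Vy; apply: near_eq_fderive (geq _ _ _ oV Vy gf) (dg _ Vy).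
have := cg _ Vx; rewrite /prop_for /continuous_at -eqfd//.
apply: cvg_trans; apply: near_eq_cvg.
have : nbhs x V by exact: open_nbhs_nbhs.
by apply: filterS => y; exact: eqfd.
Qed.

End Differentiability.

Section BlinNorm.
Context {R : realType} {E F G : normedModType R}.

Lemma blin_le_norm (f : blin E F) v : `|f v| <= `|f| * `|v|.
Proof.
have [->|v0] := eqVneq v 0; first by rewrite linear0 !normr0 mulr0.
have vp : 0 < `|v| by rewrite normr_gt0.
have : `| `|v|^-1 *: v| <= 1 by rewrite normrZ normfV normr_id mulVf ?gt_eqF.
move/(blin_norm_ub f); rewrite linearZ normrZ normfV normr_id.
by rewrite ler_pdivrMl// mulrC.
Qed.

Lemma blin_norm_bound (f : blin E F) c :
  0 <= c -> (forall v, `|f v| <= c * `|v|) -> `|f| <= c.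
Proof.
move=> c0 fc; apply: blin_norm_le => v v1; apply: le_trans (fc v) _.
by rewrite ler_piMr.
Qed.

Lemma blin_comp_subproof (g : blin F G) (f : blin E F) :
  g \o f \in @blin_pred R E G.
Proof.
apply/asboolP; split=> [a u v|x]; first by rewrite /= !linearP.
by apply: continuous_comp; exact: blin_continuous.
Qed.

Definition blin_comp (g : blin F G) (f : blin E F) : blin E G :=
  Blin (blin_comp_subproof g f).

End BlinNorm.

Section C1Composition.
Context {R : realType} {E F G : normedModType R}.

(** Composition is jointly continuous for the operator norm, because
    a0 b0 - a b = a0 (b0 - b) + (a0 - a) b. *)
Lemma blin_comp_cvg {T : Type} {H : set_system T} {FH : Filter H}
  (a : T -> blin F G) (b : T -> blin E F) a0 b0 :
  a @ H --> a0 -> b @ H --> b0 ->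
  blin_comp (a t) (b t) @[t --> H] --> blin_comp a0 b0.
Proof.
move=> aa bb; apply/cvgrPdist_le => e e0.
have : `|a0| * `|b0 - b t| + `|a0 - a t| * `|b t| @[t --> H] -->
    `|a0| * `|b0 - b0| + `|a0 - a0| * `|b0|.
  apply: cvgD; apply: cvgM.
  - exact: cvg_cst.
  - by apply: cvg_norm; apply: cvgB => //; exact: cvg_cst.
  - by apply: cvg_norm; apply: cvgB => //; exact: cvg_cst.
  - exact: cvg_norm.
rewrite !subrr !normr0 mulr0 mul0r addr0 => /cvgr_le/(_ _ e0).
apply: filterS => t; apply: le_trans.
apply: blin_norm_bound => [|v]; first by rewrite addr_ge0// mulr_ge0.
have -> : (blin_comp a0 b0 - blin_comp (a t) (b t)) v =
    a0 ((b0 - b t) v) + (a0 - a t) (b t v).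
  change (a0 (b0 v) - a t (b t v) =
    a0 (b0 v - b t v) + (a0 (b t v) - a t (b t v))).
  by rewrite linearB addrA subrK.
apply: le_trans (ler_normD _ _) _; rewrite mulrDl -!mulrA; apply: lerD.
  apply: le_trans (blin_le_norm _ _) _; rewrite ler_wpM2l//.
  exact: blin_le_norm.
apply: le_trans (blin_le_norm _ _) _; rewrite ler_wpM2l//.
exact: blin_le_norm.
Qed.

(** By the chain rule the derivative of the composite is a composite of
    derivatives, whose continuity is that of blin_comp. *)
Lemma Ck1_comp (U : set E) (V : set F) (f : E -> F) (g : F -> G) :
  open U -> Ck 1 U f -> Ck 1 V g -> (forall x, U x -> V (f x)) ->
  Ck 1 U (g \o f).
Proof.
move=> oU [df cf] [dg cg] fUV; split => x Ux.
  by apply: differentiable_comp; [exact: df|exact/dg/fUV].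
have eqfd y : U y ->
    blin_comp (fderive g (f y)) (fderive f y) = fderive (g \o f) y.
  move=> Uy; have dfy := df _ Uy; have dgy := dg _ (fUV _ Uy).
  apply: val_inj; apply/funext => v.
  have dgf := differentiable_comp dfy dgy.
  by rewrite /= !fderiveE// (diff_comp dfy dgy).
rewrite /prop_for /continuous_at -eqfd//.
apply: (@cvg_trans _ (blin_comp (fderive g (f y)) (fderive f y) @[y --> x])).
  apply: near_eq_cvg.
  have : nbhs x U by exact: open_nbhs_nbhs.
  by apply: filterS => y; exact: eqfd.
apply: blin_comp_cvg; last exact: cf.
apply: (@cvg_comp _ _ _ f (fderive g) _ (nbhs (f x))); last exact/cg/fUV.
exact: differentiable_continuous (df _ Ux).
Qed.

Lemma Ck1_is_diff (U : set E) (f : E -> F) (L : E -> blin E F) :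
  (forall x, U x -> is_diff x f (L x)) -> continuous L -> open U -> Ck 1 U f.
Proof.
move=> fL cL oU; split=> x Ux; first by have [] := fL x Ux.
have eqfd y : U y -> L y = fderive f y.
  move=> Uy; have [dfy dfE] := fL y Uy.
  by apply: val_inj; apply/funext => v; rewrite /= fderiveE// dfE.
rewrite /prop_for /continuous_at -eqfd//; apply: cvg_trans (cL x).
apply: near_eq_cvg; have : nbhs x U by exact: open_nbhs_nbhs.
by apply: filterS => y; exact: eqfd.
Qed.

End C1Composition.

(** * A variational principle with quadratic perturbations *)

Section GeometricSeries.
Context {R : realType} {V : completeNormedModType R}.

Lemma is_cvg_series_geometric_dominated (u : V ^nat) (a : R) :
  (forall n, `|u n| <= a * 2^-1 ^+ n) -> cvgn (series u).
Proof.
move=> ua; apply: normed_cvg.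
apply: (@series_le_cvg _ _ (geometric a 2^-1)) => // [n|n|].
    exact: normr_ge0.
  exact: le_trans (normr_ge0 _) (ua n).
by apply: is_cvg_geometric_series; rewrite gtr0_norm ?invf_lt1; lra.
Qed.

Lemma is_cvg_geometric_steps (x : V ^nat) (a : R) :
  (forall n, `|x n.+1 - x n| <= a * 2^-1 ^+ n) -> cvgn x.
Proof.
move=> xa; have -> : x = (fun n => x 0%N + series (telescope x) n).
  by apply/funext => n; rewrite -eq_sum_telescope.
apply: is_cvgD; first exact: is_cvg_cst.
exact: is_cvg_series_geometric_dominated xa.
Qed.

Lemma geometric_steps_bound (x : V ^nat) (a : R) n :
  (forall n, `|x n.+1 - x n| <= a * 2^-1 ^+ n) -> `|x n - x 0%N| <= 2 * a.
Proof.
move=> xa.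
have a0 : 0 <= a.
  by have := le_trans (normr_ge0 _) (xa 0%N); rewrite expr0 mulr1.
have : `|x n - x 0%N| <= 2 * a * (1 - 2^-1 ^+ n).
  elim: n => [|n IH]; first by rewrite !subrr normr0 mulr0.
  rewrite -(subrK (x n) (x n.+1)) -addrA.
  apply: le_trans (ler_normD _ _) _.
  apply: le_trans (lerD (xa n) IH) _.
  rewrite exprS; move: (2^-1 ^+ n) => t; lra.
have t0 : 0 <= 2^-1 ^+ n :> R by rewrite exprn_ge0// invr_ge0.
by move: (2^-1 ^+ n) t0 => t t0 /le_trans; apply; nra.
Qed.

End GeometricSeries.

Section VariationalPrinciple.
Context {R : realType} {E : completeNormedModType R} {dotE : {dot E for idfun}}.
Hypothesis E_hilbert : forall v : E, `|v| = Num.sqrt (dotE v v).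

(** A convergent combination of squared distances to points is again a
    quadratic function with scalar leading coefficient: expanding each square
    gives (sum of the delta k) |y|^2 - 2 (y, sum of the delta k x k) + constant.
    This is where the Hilbert norm is used to keep the perturbation of the
    variational principle smooth. *)
Lemma series_sqr_dist_quadratic (x : E ^nat) (delta : R ^nat) (a b : R) :
  (forall n, 0 <= delta n <= a * 2^-1 ^+ n) -> (forall n, `|x n| <= b) ->
  exists c w d, [/\ 0 <= c & forall y,
    series (fun k => delta k * `|y - x k| ^+ 2) @ \oo -->
      c * `|y| ^+ 2 - 2 * dotE y w + d].
Proof.
move=> da xb.
have da' n : `|delta n| <= a * 2^-1 ^+ n.
  by have /andP[d0 dn] := da n; rewrite ger0_norm.
have b0 : 0 <= b := le_trans (normr_ge0 _) (xb 0%N).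
have cvd : cvgn (series delta).
  exact: (@is_cvg_series_geometric_dominated R R^o delta a).
have cvx : cvgn (series (fun k => delta k *: x k)).
  apply: (is_cvg_series_geometric_dominated _ (a * b)) => n.
  by rewrite normrZ mulrAC ler_pM.
have cvx2 : cvgn (series (fun k => delta k * `|x k| ^+ 2)).
  apply: (@is_cvg_series_geometric_dominated R R^o _ (a * b ^+ 2)) => n.
  rewrite normrM mulrAC ler_pM// ger0_norm ?sqr_ge0//.
  by rewrite lerXn2r ?nnegrE.
exists (limn (series delta)), (limn (series (fun k => delta k *: x k))),
  (limn (series (fun k => delta k * `|x k| ^+ 2))); split.
  apply: limr_ge => //; apply: nearW => n.
  by apply: sumr_ge0 => k _; have /andP[] := da k.
move=> y.
have -> : series (fun k => delta k * `|y - x k| ^+ 2) = fun n =>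
  series delta n * `|y| ^+ 2 - 2 * dotE y (series (fun k => delta k *: x k) n)
  + series (fun k => delta k * `|x k| ^+ 2) n.
  apply/funext; elim=> [|n IH].
    by rewrite /series/= !big_geq// linear0r; ring.
  move: IH; rewrite /series/= => IH.
  rewrite !big_nat_recr//= IH (normB_sqr E_hilbert) dotDr dotZr.
  ring.
apply: cvgD => //; apply: cvgB.
  by apply: cvgM => //; exact: cvg_cst.
by apply: cvgM; [exact: cvg_cst|exact: dot_cvgr].
Qed.

Lemma approximate_minimizer (D : set E) (h : E -> R) (x0 : E) (m : R) :
  D x0 -> (forall y, D y -> m <= h y) ->
  forall e, 0 < e -> exists y, D y /\ forall z, D z -> h y <= h z + e.
Proof.
move=> Dx0 mh e e0; have hinf : has_inf (h @` D).
  by split; [exists (h x0), x0|exists m => _ [y Dy <-]; exact: mh].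
have [_ [y Dy <-] hy] := inf_adherent e0 hinf.
exists y; split=> // z Dz; apply: le_trans (ltW hy) _.
by rewrite lerD2r; apply: ge_inf; [case: hinf|exists z].
Qed.

(** The construction of Borwein and Preiss: each new point almost minimizes
    h plus the penalties centred at all the previous points, and then
    contributes a penalty of its own. *)
Lemma perturbed_minimizing_sequence (D : set E) (h : E -> R) (x0 : E)
  (eps delta : R ^nat) :
  (forall n, 0 < eps n) -> (forall n, 0 <= delta n) ->
  D x0 -> (forall y, D y -> h x0 <= h y + eps 0%N) ->
  exists x : E ^nat, [/\ x 0%N = x0, forall n, D (x n) &
    forall n, let hn y := h y + series (fun k => delta k * `|y - x k| ^+ 2) n in
      forall y, D y -> hn (x n) <= hn y + eps n].
Proof.
move=> eps0 delta0 Dx0 hx0.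
have /choice[pick pickP] (qe : (E -> R) * R) : exists y : E,
    (forall y, D y -> 0 <= qe.1 y) -> 0 < qe.2 ->
    D y /\ forall z, D z -> h y + qe.1 y <= h z + qe.1 z + qe.2.
  case: qe => q e /=.
  have [q0|] := pselect (forall y, D y -> 0 <= q y); last by exists x0.
  have [e0|] := pselect (0 < e); last by exists x0.
  have hb y : D y -> h x0 - eps 0%N <= h y + q y.
    by move=> Dy; have := hx0 _ Dy; have := q0 _ Dy; lra.
  by have [y yP] := approximate_minimizer _ _ _ _ Dx0 hb _ e0; exists y.
(* The state after n steps: the sum of the first n penalties, and the n-th
   point. *)
pose st := fix st n := if n is m.+1 then
    let q y := (st m).1 y + delta m * `|y - (st m).2| ^+ 2 in
    (q, pick (q, eps m.+1))
  else (cst 0 : E -> R, x0).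
pose x n := (st n).2.
have qE n y : (st n).1 y = series (fun k => delta k * `|y - x k| ^+ 2) n.
  elim: n => [|n IH]; first by rewrite /series/= big_geq.
  by rewrite /series/= big_nat_recr//= IH.
have q0 n y : 0 <= (st n).1 y.
  by rewrite qE; apply: sumr_ge0 => k _; rewrite mulr_ge0// sqr_ge0.
exists x; split=> // [[//|n]|[|n] /= y Dy].
- by have [] := pickP ((st n.+1).1, eps n.+1) (fun y _ => q0 n.+1 y) (eps0 _).
- by rewrite /series/= !big_geq// !addr0; exact: hx0.
- rewrite -!qE.
  have [_] := pickP ((st n.+1).1, eps n.+1) (fun y _ => q0 n.+1 y) (eps0 _).
  by apply.
Qed.

(** Comparing the near-minimality of x n and of x n.+1 gives
    delta n |x n.+1 - x n|^2 <= 2 eps n, so the sequence converges as soon as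
    eps decreases much faster than delta.  The total perturbation is a quadratic
    function by series_sqr_dist_quadratic, and the limit point minimizes h plus
    it.  The hypothesis on sequences in D says that the epigraph of h over D is
    closed; D plays the part of an effective domain, so h is real-valued. *)
Lemma quadratic_variational_principle (D : set E) (h : E -> R) (x0 : E)
    (rho : R) :
  0 < rho -> D x0 -> (forall y, D y -> h x0 <= h y + 1) ->
  (forall (u : E ^nat) x a, (forall n, D (u n)) -> u @ \oo --> x ->
     (forall e, 0 < e -> \forall n \near \oo, h (u n) <= a + e) ->
     D x /\ h x <= a) ->
  exists c w x, [/\ 0 <= c, D x, `|x - x0| <= 2 * rho & forall y, D y ->
    h x + (c * `|x| ^+ 2 - 2 * dotE x w) <=
    h y + (c * `|y| ^+ 2 - 2 * dotE y w)].
Proof.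
move=> rho0 Dx0 hx0 epi.
(* With these values 2 eps n / delta n is the square of rho 2^-n, while delta
   remains summable. *)
pose eps n : R := 8^-1 ^+ n.
pose delta n : R := 2 / rho ^+ 2 * 2^-1 ^+ n.
have h2 n : 0 < 2^-1 ^+ n :> R by rewrite exprn_gt0// invr_gt0.
have eps0 n : 0 < eps n by rewrite exprn_gt0// invr_gt0.
have delta0 n : 0 < delta n by rewrite mulr_gt0// divr_gt0// exprn_gt0.
have [x [x00 Dx xmin]] :
    exists x : E ^nat, [/\ x 0%N = x0, forall n, D (x n) &
    forall n, let hn y := h y + series (fun k => delta k * `|y - x k| ^+ 2) n in
      forall y, D y -> hn (x n) <= hn y + eps n].
  by apply: perturbed_minimizing_sequence => // n; exact: ltW.
have step n : `|x n.+1 - x n| <= rho * 2^-1 ^+ n.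
  have := xmin n _ (Dx n.+1); have := xmin n.+1 _ (Dx n).
  rewrite /series/= !big_nat_recr//= subrr normr0 expr0n/= mulr0 addr0.
  move: (h _) (h _) (\sum_(_ <= _ < _) _) (\sum_(_ <= _ < _) _).
  move=> a b c d.
  have -> : eps n.+1 = 8^-1 * eps n by rewrite /eps exprS.
  move=> H1 H2.
  have : delta n * `|x n.+1 - x n| ^+ 2 <= 2 * eps n.
    have := eps0 n; move: H1 H2; lra.
  rewrite /delta /eps (_ : 8^-1 = 2^-1 * 2^-1 ^+ 2 :> R); last by field.
  rewrite exprMn exprAC [X in _ -> _ <= X]mulrC => H.
  have r2 : 0 < rho ^+ 2 by rewrite exprn_gt0.
  have rt0 : 0 <= 2^-1 ^+ n * rho by rewrite mulr_ge0// ltW.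
  rewrite -(@ler_pXn2r _ 2) ?nnegrE//.
  have k0 : 0 < 2 / rho ^+ 2 * 2^-1 ^+ n := delta0 n.
  rewrite -(ler_pM2l k0); apply: le_trans H _.
  rewrite [X in _ <= X](_ : _ = 2 * (2^-1 ^+ n * 2^-1 ^+ n ^+ 2))//.
  by move: (2^-1 ^+ n) => t; field; rewrite gt_eqF.
have [xl xcvg] : exists xl : E, x @ \oo --> xl.
  exists (limn x); exact: is_cvg_geometric_steps step.
have xb n : `|x n - x0| <= 2 * rho.
  by rewrite -x00; exact: geometric_steps_bound step.
have xb' n : `|x n| <= `|x0| + 2 * rho.
  by rewrite -(subrK x0 (x n)) addrC (le_trans (ler_normD _ _))// lerD2l.
have deltab n : 0 <= delta n <= 2 / rho ^+ 2 * 2^-1 ^+ n by rewrite ltW/=.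
have [c [w [d [c0 qcvg]]]] := series_sqr_dist_quadratic x _ _ _ deltab xb'.
exists c, w, xl.
have qle n y : series (fun k => delta k * `|y - x k| ^+ 2) n <=
    c * `|y| ^+ 2 - 2 * dotE y w + d.
  have ndec : nondecreasing_seq (series (fun k => delta k * `|y - x k| ^+ 2)).
    by apply: nondecreasing_series => k _ _; rewrite mulr_ge0 ?sqr_ge0 ?ltW.
  have := nondecreasing_cvgn_le ndec (cvgP _ (qcvg y)) n.
  by rewrite (cvg_lim _ (qcvg y)).
have qcont m : series (fun k => delta k * `|x n - x k| ^+ 2) m @[n --> \oo] -->
    series (fun k => delta k * `|xl - x k| ^+ 2) m.
  elim: m => [|m IH].
    rewrite /series/= big_geq//; under eq_fun do rewrite big_geq//.
    exact: cvg_cst.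
  rewrite /series/= big_nat_recr//=; under eq_fun do rewrite big_nat_recr//=.
  apply: cvgD; first exact: IH.
  apply: cvgM; first exact: cvg_cst.
  have : `|x n - x m| @[n --> \oo] --> `|xl - x m|.
    by apply: cvg_norm; apply: cvgB => //; exact: cvg_cst.
  by move=> H; rewrite expr2; apply: cvgM.
(* The sum of the first m penalties is continuous, so it can be passed to the
   limit along x; m tends to infinity only afterwards. *)
have key y m : D y -> D xl /\
    h xl <= h y + (c * `|y| ^+ 2 - 2 * dotE y w + d)
            - series (fun k => delta k * `|xl - x k| ^+ 2) m.
  move=> Dy; apply: (epi x) => // e e0.
  have e2 : 0 < e / 2 by rewrite divr_gt0.
  have eps_cvg : eps @ \oo --> 0.
    by apply: cvg_expr; rewrite gtr0_norm ?invr_gt0// invf_lt1//; lra.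
  near=> n.
  have en : eps n < e / 2 by near: n; exact: cvgr_lt eps_cvg _ e2.
  have qn : series (fun k => delta k * `|xl - x k| ^+ 2) m - e / 2 <
      series (fun k => delta k * `|x n - x k| ^+ 2) m.
    by near: n; apply: cvgr_gt (qcont m) _ _; rewrite gtrBl.
  have := xmin n _ Dy; have := qle n y.
  have : series (fun k => delta k * `|x n - x k| ^+ 2) m <=
         series (fun k => delta k * `|x n - x k| ^+ 2) n.
    apply: nondecreasing_series => [k _ _|];
      last by near: n; exact: nbhs_infty_ge.
    by rewrite mulr_ge0 ?sqr_ge0 ?ltW.
  move=> /=; lra.
split => //.
- by have [] := key x0 0%N Dx0.
- have nx : `|x n - x0| @[n --> \oo] --> `|xl - x0|.
    by apply: cvg_norm; apply: cvgB => //; exact: cvg_cst.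
  by apply: cvgr_to_le nx _; exact: nearW.
- move=> y Dy.
  have : c * `|xl| ^+ 2 - 2 * dotE xl w + d <=
      h y + (c * `|y| ^+ 2 - 2 * dotE y w + d) - h xl.
    apply: cvgr_to_le (qcvg xl) _; apply: nearW => m.
    by have [_] := key y m Dy; lra.
  lra.
Unshelve. all: by end_near. Qed.

End VariationalPrinciple.

(** * Radial bumps *)

Section Bump.
Context {R : realType} {E : normedModType R} {dotE : {dot E for idfun}}.
Hypothesis E_hilbert : forall v : E, `|v| = Num.sqrt (dotE v v).

Lemma riesz_subproof (v : E) : dotE v \in @blin_pred R E R.
Proof.
apply/asboolP; split=> [a u w|x]; first by rewrite dotDr dotZr.
by apply: (dot_cvgr E_hilbert); exact: cvg_id.
Qed.

Definition riesz (v : E) : blin E R := Blin (riesz_subproof v).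

Lemma riesz_continuous : continuous riesz.
Proof.
move=> x; apply/cvgrPdist_le => e e0; near=> t.
apply: (@le_trans _ _ `|x - t|); last by near: t; exact: cvgr_dist_le.
apply: blin_norm_bound => // v.
change (`|dotE x v - dotE t v| <= `|x - t| * `|v|).
by rewrite -dotBl; exact: cauchy_schwarz.
Unshelve. all: by end_near. Qed.

Definition radial_bump (c s : R) (z y : E) : R :=
  c * Num.max 0 (s ^+ 2 - `|y - z| ^+ 2) ^+ 2.

Definition radial_bump_gradient (c s : R) (z y : E) : blin E R :=
  (- (4 * c * Num.max 0 (s ^+ 2 - `|y - z| ^+ 2))) *: riesz (y - z).

(** The square of the positive part is C1 with a quadratic remainder; this is
    the only regularity of the cut-off that enters the bumps. *)
Lemma max0_sqr_expansion (t d : R) :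
  0 <= Num.max 0 (t + d) ^+ 2 - Num.max 0 t ^+ 2 - 2 * Num.max 0 t * d
    <= d ^+ 2.
Proof. by case: (leP 0 t) => ?; case: (leP 0 (t + d)) => ?; nra. Qed.

Lemma is_diff_radial_bump c s z y :
  is_diff y (radial_bump c s z) (radial_bump_gradient c s z y).
Proof.
set p := Num.max 0 (s ^+ 2 - `|y - z| ^+ 2).
have p0 : 0 <= p by rewrite le_max lexx.
apply: (@is_diff_quadratic _ _ _ _ _ (radial_bump_gradient c s z y)
  (`|c| * ((2 * `|y - z| + 1) ^+ 2 + 2 * p))).
  exact: blin_continuous.
move=> h h1.
rewrite [X in `|_ - X|](_ : _ = - (4 * c * p) * dotE (y - z) h)//.
rewrite /radial_bump (addrAC y h) (normD_sqr E_hilbert) -/p.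
set d := dotE _ _; pose tau := - 2 * d - `|h| ^+ 2.
rewrite (_ : s ^+ 2 - (`|y - z| ^+ 2 + 2 * d + `|h| ^+ 2) =
    s ^+ 2 - `|y - z| ^+ 2 + tau); last first.
  by rewrite /tau; ring.
have /andP[] := max0_sqr_expansion (s ^+ 2 - `|y - z| ^+ 2) tau.
rewrite -/p; set q := Num.max _ _ => q0 q1.
rewrite (_ : _ - _ - _ =
    c * (q ^+ 2 - p ^+ 2 - 2 * p * tau - 2 * p * `|h| ^+ 2));
  last by rewrite /tau; ring.
rewrite normrM -[leRHS]mulrA ler_wpM2l//.
have tau_le : tau ^+ 2 <= (2 * `|y - z| + 1) ^+ 2 * `|h| ^+ 2.
  have := cauchy_schwarz E_hilbert (y - z) h; rewrite -/d => dle.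
  rewrite -exprMn -(real_normK (num_real tau)) lerXn2r ?nnegrE//.
  apply: le_trans (ler_normB _ _) _.
  rewrite normrM normrN [`|2|]ger0_norm// [`| _ ^+ 2|]ger0_norm ?sqr_ge0//.
  have : `|h| ^+ 2 <= `|h| by rewrite expr2 ler_piMr.
  by move: dle; lra.
rewrite ler_norml; apply/andP; split.
  have := sqr_ge0 `|h|; nra.
rewrite mulrDl.
have := sqr_ge0 `|h|; nra.
Qed.

Lemma Ck1_radial_bump c s z : Ck 1 setT (radial_bump c s z).
Proof.
apply: (Ck1_is_diff _ _ (radial_bump_gradient c s z)); last exact: openT.
  by move=> y _; exact: is_diff_radial_bump.
move=> y; apply: cvgZ; last first.
  apply: (@cvg_comp _ _ _ (fun y => y - z) riesz _ (nbhs (y - z))).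
    by apply: cvgB; [exact: cvg_id|exact: cvg_cst].
  exact: riesz_continuous.
apply: cvgN; apply: cvgM; first exact: cvg_cst.
have sub_cvg : {for y, continuous (fun t => s ^+ 2 - `|t - z| ^+ 2 : R^o)}.
  apply: cvgB; first exact: cvg_cst.
  have nyz : `|t - z| @[t --> y] --> `|y - z|.
    by apply: cvg_norm; apply: cvgB; [exact: cvg_id|exact: cvg_cst].
  by rewrite expr2; exact: cvgM.
exact: (continuous_max (@cst_continuous _ _ (0 : R^o) y) sub_cvg).
Qed.

Lemma radial_bump_support c s z y :
  0 <= s -> s <= `|y - z| -> radial_bump c s z y = 0.
Proof.
move=> s0 sy; rewrite /radial_bump max_l ?expr0n ?mulr0//.
by rewrite subr_le0 lerXn2r ?nnegrE.
Qed.

(** Any prescribed gradient v at x is attained by a bump that is moreover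
    concave enough there, with modulus k, to lie below the paraboloid
    (v, h) - k |h|^2.  The centre is displaced by u = - v / 4k to produce the
    gradient, and the factor c is then fixed by c (s^2 - |u|^2) = k. *)
Lemma radial_bump_peak (x v : E) (k s : R) : 0 < k -> 0 < s -> `|v| <= k * s ->
  exists c z, `|z - x| <= s / 4 /\ forall h, `|h| <= s / 4 ->
    radial_bump c s z (x + h) - radial_bump c s z x <= dotE v h - k * `|h| ^+ 2.
Proof.
move=> k0 s0 vk; pose u := - (4 * k)^-1 *: v.
have us : `|u| <= s / 4.
  rewrite normrZ normrN gtr0_norm ?invr_gt0 ?mulr_gt0//.
  by rewrite ler_pdivrMl ?mulr_gt0//; lra.
have a0 : 0 < s ^+ 2 - `|u| ^+ 2 by have := normr_ge0 u; nra.
pose c := k / (s ^+ 2 - `|u| ^+ 2).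
have ca : c * (s ^+ 2 - `|u| ^+ 2) = k by rewrite /c divfK// gt_eqF.
exists c, (x - u); split; first by rewrite addrAC subrr add0r normrN.
move=> h hs.
have vu : dotE v h = - 4 * k * dotE u h.
  by rewrite /u dotZl; field; rewrite gt_eqF.
rewrite /radial_bump opprB !(addrC x) addrA addrAC addrK subrK addrC.
set d := dotE u h in vu *; pose e := 2 * d + `|h| ^+ 2.
have max0_sqr_le (t : R) : Num.max 0 t ^+ 2 <= t ^+ 2.
  by case: (leP 0 t) => // ?; rewrite expr0n sqr_ge0.
have c0 : 0 < c by rewrite divr_gt0.
have [u0 h0] := (normr_ge0 u, normr_ge0 h).
have e_le : e ^+ 2 <= (s ^+ 2 - `|u| ^+ 2) * `|h| ^+ 2.
  have : `|e| <= (2 * `|u| + `|h|) * `|h|.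
    apply: le_trans (ler_normD _ _) _; rewrite normrM ger0_norm//.
    rewrite [`| _ ^+ 2|]ger0_norm ?sqr_ge0//.
    by have := cauchy_schwarz E_hilbert u h; rewrite -/d; nra.
  move=> e_le; rewrite -(real_normK (num_real e)).
  apply: (@le_trans _ _ (((2 * `|u| + `|h|) * `|h|) ^+ 2)).
    by rewrite lerXn2r ?nnegrE// mulr_ge0// addr_ge0// mulr_ge0.
  rewrite exprMn ler_wpM2r ?sqr_ge0//; nra.
rewrite [X in _ - X](_ : _ = c * (s ^+ 2 - `|u| ^+ 2) ^+ 2); last first.
  by rewrite max_r ?ltW.
apply: (@le_trans _ _ (c * (s ^+ 2 - `|u| ^+ 2 - e) ^+ 2
                       - c * (s ^+ 2 - `|u| ^+ 2) ^+ 2)).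
  rewrite lerD2r ler_wpM2l//; first exact: ltW.
  apply: le_trans (max0_sqr_le _) _; rewrite le_eqVlt; apply/orP; left.
  apply/eqP; congr (_ ^+ 2).
  by rewrite (normD_sqr E_hilbert) -/d /e; ring.
rewrite vu; move: (s ^+ 2 - _) ca e_le => a ca e_le.
have : c * e ^+ 2 <= k * `|h| ^+ 2 by rewrite -ca -mulrA ler_wpM2l// ltW.
rewrite (_ : c * (a - e) ^+ 2 - c * a ^+ 2 = - 2 * (c * a) * e + c * e ^+ 2).
  rewrite ca /e; lra.
by ring.
Qed.

End Bump.

(** * Charts and the metric in charts *)

Section Charts.
Context {R : realType} {E : normedModType R} {M : topologicalType}.
Context {A : atlas E M}.
Implicit Types i j k : chart_index A.

Lemma chart_dom_nbhs i p : chart_dom i p -> nbhs p (chart_dom i).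
Proof.
by move=> ip; apply: open_nbhs_nbhs; split=> //; exact: chart_dom_open. Qed.

Lemma chart_cvg i p : chart_dom i p -> {for p, continuous (chart i)}.
Proof.
have := @chart_continuous _ _ _ A i.
rewrite continuous_open_subspace; last exact: chart_dom_open.
by move=> ci ip; apply: ci; rewrite inE.
Qed.

Lemma chart_inv_cvg i x : chart_img i x -> {for x, continuous (chart_inv i)}.
Proof.
have := @chart_inv_continuous _ _ _ A i.
rewrite continuous_open_subspace; last exact: chart_img_open.
by move=> ci ix; apply: ci; rewrite inE.
Qed.

Lemma chart_inv_dom i x : chart_img i x -> chart_dom i (chart_inv i x).
Proof. by move=> [p ip <-]; rewrite chartK. Qed.

Lemma chart_invK i x : chart_img i x -> chart i (chart_inv i x) = x.
Proof. by move=> [p ip <-]; rewrite chartK. Qed.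

Lemma chart_imgP i p : chart_dom i p -> chart_img i (chart i p).
Proof. by move=> ip; exists p. Qed.

Lemma overlap_open i j : open (chart i @` (chart_dom i `&` chart_dom j)).
Proof.
rewrite openE => _ [p [ip jp] <-]; rewrite /interior.
have iimg : nbhs (chart i p) (chart_img i).
  by apply: open_nbhs_nbhs; split; [exact: chart_img_open|exact: chart_imgP].
have := @chart_inv_cvg i _ (chart_imgP _ _ ip).
rewrite /prop_for /continuous_at chartK// => /(_ _ (chart_dom_nbhs _ _ jp)).
apply: filterS2 iimg => x ix jx.
exists (chart_inv i x); last exact: chart_invK.
by split => //; exact: chart_inv_dom.
Qed.

Lemma overlap_nbhs i j p : chart_dom i p -> chart_dom j p ->
  nbhs (chart i p) (chart i @` (chart_dom i `&` chart_dom j)).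
Proof.
by move=> ip jp; apply: open_nbhs_nbhs; split; [exact: overlap_open|exists p].
Qed.

Lemma transition_differentiable i j p : chart_dom i p -> chart_dom j p ->
  differentiable (chart j \o chart_inv i) (chart i p).
Proof.
by move=> ip jp; have [+ _] := @transition_Cinfty _ _ _ A i j 1; apply;
  exists p.
Qed.

Lemma change_chart_near {T : Type} (h : M -> T) i j p :
  chart_dom i p -> chart_dom j p -> \forall y \near chart i p,
    ((h \o chart_inv j) \o (chart j \o chart_inv i)) y = (h \o chart_inv i) y.
Proof.
move=> ip jp; apply: filterS (overlap_nbhs _ _ _ ip jp) => _ [q [iq jq] <-] /=.
by rewrite !chartK.
Qed.

(** Both the cocycle identity for tangent vectors (h a chart) and the chart
    independence of differentials (h a real function) are instances. *)
Lemma is_diff_change_chart {F : normedModType R} (h : M -> F) i j p :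
  chart_dom i p -> chart_dom j p ->
  differentiable (h \o chart_inv j) (chart j p) ->
  is_diff (chart i p) (h \o chart_inv i)
    ('d (h \o chart_inv j) (chart j p) \o
     'd (chart j \o chart_inv i) (chart i p)).
Proof.
move=> ip jp dh.
have dt := transition_differentiable _ _ _ ip jp.
have tE : (chart j \o chart_inv i) (chart i p) = chart j p by rewrite /= chartK.
have dh' :
    differentiable (h \o chart_inv j) ((chart j \o chart_inv i) (chart i p)).
  by rewrite tE.
have [d1 d2] := near_eq_is_diff _ _ _ (change_chart_near h _ _ _ ip jp)
  (differentiable_comp dt dh').
by apply: DiffDef => //; rewrite d2 (diff_comp dt dh') tE.
Qed.

(** The cocycle identity makes the family of images of v under the transition
    maps a tangent vector.  Bounds on the metric, which speak of tangent
    vectors, thus become bounds on vectors of the model space. *)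
Lemma tangent_of_coord i p (v : E) : chart_dom i p ->
  exists X : tangent A p, X i = v.
Proof.
move=> ip.
pose X k : E := if `[< chart_dom k p >] then
  'd (chart k \o chart_inv i) (chart i p) v else 0.
have Xt : X \in @tangent_pred _ _ _ A p.
  apply/asboolP; split=> [k nkp|k l kp lp].
    by rewrite /X asboolF.
  rewrite /X !asboolT//.
  have := is_diff_change_chart (chart l) i k p ip kp
    (transition_differentiable _ _ _ kp lp).
  by move=> [_ ->].
exists (Tangent Xt); rewrite /= /X asboolT//.
have [_ ->] :
    is_diff (chart i p) (chart i \o chart_inv i) ('d idfun (chart i p)).
  apply: near_eq_is_diff; last exact: ex_diff.
  apply: filterS (overlap_nbhs _ _ _ ip ip) => _ [q [iq _] <-] /=.
  by rewrite chartK.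
by rewrite (diff_val (f := idfun)).
Qed.

Section MetricBounds.
Variable g : riemannian_metric A.

Lemma metric_ge0 p (X : tangent A p) : 0 <= g p X X.
Proof.
have [->|X0] := eqVneq X 0; first by rewrite linear0r.
exact: ltW (neq0_dnorm_gt0 _ X0).
Qed.

(** The metric coefficients are continuous for the operator norm, so the metric
    read in a chart is uniformly close, on bounded sets of vectors, to the
    quadratic form b that it induces at p0. *)
Lemma metric_near i p0 e : chart_dom i p0 -> 0 < e ->
  exists (r : R) (b : E -> R), 0 < r /\
  [/\ forall X : tangent A p0, g p0 X X = b (X i),
    exists K, forall v, b v <= K * `|v| ^+ 2 &
    forall p, chart_dom i p -> `|chart i p - chart i p0| < r ->
      forall X : tangent A p, `|g p X X - b (X i)| <= e * `|X i| ^+ 2].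
Proof.
move=> ip0 e0; have [G Ginf gG] := metric_Cinfty g i.
have Gcvg : {for chart i p0, continuous G} := Ginf 0 _ (chart_imgP _ _ ip0).
have : \forall x \near chart i p0, `|G (chart i p0) - G x| <= e.
  exact: cvgr_dist_le Gcvg _ e0.
move=> /nbhs_ballP[r /= r0]; rewrite -ball_normE => rG.
have norm2 (B : blin E (blin E R)) v : `|B v v| <= `|B| * `|v| ^+ 2.
  apply: le_trans (blin_le_norm _ _) _; rewrite expr2 mulrA ler_wpM2r//.
  exact: blin_le_norm.
exists r, (fun v => G (chart i p0) v v); split => //; split.
- by move=> X; exact: gG.
- exists `|G (chart i p0)| => v.
  exact: le_trans (ler_norm _) (norm2 _ _).
- move=> p ip pr X; rewrite gG// distrC.
  have /= := rG (chart i p); rewrite [X in X < r]distrC => /(_ pr) H.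
  apply: le_trans (norm2 (G (chart i p0) - G (chart i p)) _) _.
  by rewrite ler_wpM2r ?sqr_ge0.
Qed.

Lemma metric_lower_bound i p0 : chart_dom i p0 ->
  exists r c : R, [/\ 0 < r, 0 < c & forall p, chart_dom i p ->
    `|chart i p - chart i p0| < r ->
    forall X : tangent A p, c * `|X i| ^+ 2 <= g p X X].
Proof.
move=> ip0; have [c [C [c0 _ cg]]] := metric_equiv g ip0.
have c2 : 0 < c ^+ 2 / 2 by rewrite divr_gt0// exprn_gt0.
have [r [b [r0 [gb _ gnear]]]] := metric_near _ _ _ ip0 c2.
exists r, (c ^+ 2 / 2); split=> // p ip pr X.
have [Y YX] := tangent_of_coord i p0 (X i) ip0.
have := cg Y => /andP[+ _]; rewrite YX => cY.
have : c ^+ 2 * `|X i| ^+ 2 <= b (X i).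
  rewrite -YX -gb -(sqr_sqrtr (metric_ge0 p0 Y)) -exprMn.
  by rewrite lerXn2r ?nnegrE ?sqrtr_ge0 ?YX// mulr_ge0// ltW.
have := gnear p ip pr X; rewrite ler_norml => /andP[+ _]; lra.
Qed.

Lemma metric_upper_bound i p0 : chart_dom i p0 ->
  exists r C : R, [/\ 0 < r, 0 < C & forall p, chart_dom i p ->
    `|chart i p - chart i p0| < r ->
    forall X : tangent A p, g p X X <= C * `|X i| ^+ 2].
Proof.
move=> ip0.
have [r [b [r0 [gb [K bK] gnear]]]] :=
  metric_near _ _ _ ip0 (ltr01 : 0 < 1 :> R).
exists r, (`|K| + 1); split=> //.
move=> p ip pr X; have := bK (X i).
have := gnear p ip pr X; rewrite ler_norml => /andP[_].
have : K * `|X i| ^+ 2 <= `|K| * `|X i| ^+ 2.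
  by rewrite ler_wpM2r ?sqr_ge0 ?ler_norm.
lra.
Qed.

(** For the metric, a tangent vector at q has a length bounded below by its
    coordinate in i and above by its coordinate in j; the transition map is
    therefore Lipschitz at q.  The radius r around p0 is chosen before the
    chart j and the point q0: this uniformity is what separates p0 from all
    the points outside of the chart domain at once. *)
Lemma transition_diff_bound i p0 : chart_dom i p0 -> exists2 r : R, 0 < r &
  forall j q0, chart_dom j q0 -> exists s L : R, [/\ 0 < s, 0 < L &
    forall q, chart_dom i q -> chart_dom j q ->
      `|chart i q - chart i p0| < r -> `|chart j q - chart j q0| < s ->
      forall v, `|'d (chart i \o chart_inv j) (chart j q) v| <= L * `|v|].
Proof.
move=> ip0; have [r [c [r0 c0 gc]]] := metric_lower_bound i p0 ip0.
exists r => // j q0 jq0.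
have [s [C [s0 C0 gC]]] := metric_upper_bound j q0 jq0.
exists s, (Num.sqrt (C / c)); split=> //.
  by rewrite sqrtr_gt0 divr_gt0.
move=> q iq jq qr qs v.
have [X Xv] := tangent_of_coord j q v jq.
have /asboolP[_ Xij] := valP X.
have := Xij j i jq iq; rewrite /= Xv => <-.
have := le_trans (gc q iq qr X) (gC q jq qs X); rewrite Xv => H.
rewrite -(@ler_pXn2r _ 2) ?nnegrE ?mulr_ge0 ?sqrtr_ge0//.
rewrite exprMn sqr_sqrtr; last by rewrite divr_ge0 ?ltW.
by rewrite mulrAC ler_pdivlMr// mulrC.
Qed.

End MetricBounds.
End Charts.

(** * Curves *)

Section Curves.
Context {R : realType}.

(** Induction along an interval: the supremum of the initial segments on which
    P holds can only be 1. *)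
Lemma unit_interval_induction (P : R -> Prop) :
  P 0 ->
  (forall t, 0 < t <= 1 -> (forall s, 0 <= s < t -> P s) -> P t) ->
  (forall t, 0 <= t < 1 -> P t -> \forall s \near t, P s) ->
  P 1.
Proof.
move=> P0 Pleft Popen.
pose S := [set t | 0 <= t <= 1 /\ forall s, 0 <= s <= t -> P s].
have S0 : S 0.
  split=> [|s]; first by rewrite lexx ler01.
  by rewrite -eq_le => /eqP<-.
have supS : has_sup S by split; [exists 0|exists 1 => t [/andP[]]].
have c0 : 0 <= sup S by exact: (sup_upper_bound supS).
have c1 : sup S <= 1 by apply: ge_sup; [exists 0|move=> t [/andP[]]].
have below s : 0 <= s < sup S -> P s.
  move=> /andP[s0 sc]; have e0 : 0 < sup S - s by rewrite subr_gt0.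
  have [t [_ tP]] := sup_adherent e0 supS.
  by rewrite subKr => /ltW st; apply: tP; rewrite s0.
have Pc : P (sup S).
  have [<-//|c_neq0] := eqVneq 0 (sup S).
  by apply: Pleft => //; rewrite c1 lt_neqAle c_neq0 c0.
have [c_lt1|] := ltP (sup S) 1; last first.
  by move=> c_ge1; have <- : sup S = 1 by apply/eqP; rewrite eq_le c1.
have cI : 0 <= sup S < 1 by rewrite c0.
have /nbhs_ballP[d /= d0 dP] := Popen _ cI Pc.
pose t := Num.min 1 (sup S + d / 2).
have tc : sup S < t by rewrite lt_min c_lt1 ltrDl divr_gt0.
suff /(sup_upper_bound supS) : S t by rewrite leNgt tc.
split=> [|s /andP[s0 st]].
  by rewrite (le_trans c0 (ltW tc))/= /t ge_min lexx.
have [sc|cs] := ltP s (sup S); first by apply: below; rewrite s0.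
apply: dP; rewrite /ball /= distrC ger0_norm ?subr_ge0//.
have : t <= sup S + d / 2 by rewrite ge_min lexx orbT.
by lra.
Qed.

Lemma lipschitz_left_limit {E : completeNormedModType R} (u : R -> E)
  (a b K : R) : a < b ->
  (forall s t, a <= s -> s <= t -> t < b -> `|u t - u s| <= K * (t - s)) ->
  exists l : E, u @ b^'- --> l.
Proof.
move=> ab uK; exists (lim (u @ b^'-)); apply/cauchy_cvgP/cauchyP => e e0.
have K0 : 0 <= `|K| by [].
pose t0 := Num.max a (b - e / (`|K| + 1)).
have d0 : 0 < e / (`|K| + 1) by rewrite divr_gt0// ltr_wpDl.
have t0b : t0 < b by rewrite gt_max ab gtrBl.
have at0 : a <= t0 by rewrite le_max lexx.
exists (u t0).
suff : \forall t \near b^'-, ball (u t0) e (u t) by [].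
near=> t; rewrite /= -ball_normE/= distrC.
have tt0 : t0 < t by near: t; exact: nbhs_left_gt.
have tb : t < b by near: t; exact: nbhs_left_lt.
apply: le_lt_trans (uK _ _ at0 (ltW tt0) tb) _.
have : b - e / (`|K| + 1) <= t0 by rewrite le_max lexx orbT.
have : e / (`|K| + 1) * (`|K| + 1) = e by rewrite divfK// gt_eqF// ltr_wpDl.
have := ler_norm K; move: d0; set d := _ / _; nra.
Unshelve. all: by end_near. Qed.

(** The scalar mean value theorem applied to the component of the curve along
    its own displacement u b - u a. *)
Lemma curve_lipschitz {E : normedModType R} {dotE : {dot E for idfun}}
  (E_hilbert : forall v : E, `|v| = Num.sqrt (dotE v v))
  (u : R -> E) (a b K : R) : a <= b ->
  (forall t, a <= t <= b -> differentiable u t /\ `|'d u t 1| <= K) ->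
  `|u b - u a| <= K * (b - a).
Proof.
move=> ab uK; pose w := u b - u a; pose f t := dotE w (u t).
have fd t : t \in `[a, b] -> is_derive t 1 f (dotE w ('d u t 1)).
  rewrite in_itv/= => /uK[du _].
  have dw : differentiable (riesz E_hilbert w) (u t).
    exact/linear_differentiable/blin_continuous.
  have df : differentiable f t by exact: (differentiable_comp du dw).
  apply: DeriveDef; first exact: diff_derivable.
  rewrite deriveE//.
  have -> : 'd f t = 'd (riesz E_hilbert w \o u) t by [].
  rewrite (diff_comp du dw)/= diff_lin//.
  exact: (@blin_continuous _ _ _ (riesz E_hilbert w)).
have fcont : {within `[a, b], continuous f}.
  by apply: derivable_within_continuous => t tab; have [] := fd t tab.
have fd' t : t \in `]a, b[%R -> is_derive t 1 f (dotE w ('d u t 1)).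
  by move=> /subset_itv_oo_cc; exact: fd.
have [t0 tab fE] := MVT_segment ab fd' fcont.
have [_ t0K] : differentiable u t0 /\ `|'d u t0 1| <= K.
  by apply: uK; move: tab; rewrite in_itv.
have wE : `|w| ^+ 2 = dotE w ('d u t0 1) * (b - a).
  by rewrite -fE /f -dotBr (dot_norm E_hilbert).
have [w0|w0] := eqVneq `|w| 0.
  by rewrite w0 mulr_ge0 ?subr_ge0// (le_trans _ t0K).
have wp : 0 < `|w| by rewrite lt_neqAle eq_sym w0/=.
rewrite -(ler_pM2l wp) -expr2 wE mulrA ler_wpM2r ?subr_ge0//.
apply: le_trans (ler_norm _) _.
apply: le_trans (cauchy_schwarz E_hilbert _ _) _.
by rewrite ler_wpM2l.
Qed.

End Curves.

(** * Separation of small chart balls from the rest of the manifold *)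

Section Regularity.
Context {R : realType} {E : completeNormedModType R} {dotE : {dot E for idfun}}.
Hypothesis E_hilbert : forall v : E, `|v| = Num.sqrt (dotE v v).

Lemma is_diff_line (y w : E) (t : R) :
  is_diff t (fun s : R => y + s *: w) (fun s => s *: w).
Proof.
have -> : (fun s : R => y + s *: w) = cst y + (fun s : R => s *: w) by [].
by apply: is_diff_eq; apply/funext => s /=; rewrite !fctE add0r.
Qed.

Context {M : topologicalType} (M_hausdorff : hausdorff_space M).
Context {A : atlas E M} (g : riemannian_metric A).
Implicit Types i j k : chart_index A.

(** If q lies outside of the domain of the chart i, no point q' close to q is in
    the small ball around p0.  Otherwise join q' to q by a segment read in a
    chart j at q.  As long as the segment stays in the ball of radius 2 r of
    the chart i, its image u there is Lipschitz with a constant smaller than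
    r / 2, so it cannot reach the boundary of that ball; being Cauchy it has a
    limit, which by Hausdorffness is the image of the point of the segment.
    Hence the whole segment remains in the domain of i, including its end q. *)
Lemma chart_ball_separated i p0 : chart_dom i p0 -> exists2 r : R, 0 < r &
  (forall x, `|x - chart i p0| < 2 * r -> chart_img i x) /\
  forall q, ~ chart_dom i q ->
    \forall q' \near q, ~ (chart_dom i q' /\ `|chart i q' - chart i p0| <= r).
Proof.
move=> ip0; have [r1 r10 r1P] := transition_diff_bound g i p0 ip0.
have : nbhs (chart i p0) (chart_img i).
  by apply: open_nbhs_nbhs; split; [exact: chart_img_open|exact: chart_imgP].
move=> /nbhs_ballP[r2 /= r20]; rewrite -ball_normE => r2P.
pose r := Num.min r1 r2 / 2.
have r0 : 0 < r by rewrite divr_gt0// lt_min r10.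
have rr1 : 2 * r <= r1 by rewrite mulrC divfK// ge_min lexx.
have rr2 : 2 * r <= r2 by rewrite mulrC divfK// ge_min lexx orbT.
have img x : `|x - chart i p0| < 2 * r -> chart_img i x.
  by move=> xr; apply: r2P; rewrite /= distrC; exact: lt_le_trans rr2.
exists r => //; split=> // q niq.
have [j jq] := chart_cover A q.
have [s [L [s0 L0 tL]]] := r1P j q jq.
have : nbhs (chart j q) (chart_img j).
  by apply: open_nbhs_nbhs; split; [exact: chart_img_open|exact: chart_imgP].
move=> /nbhs_ballP[s2 /= s20]; rewrite -ball_normE => s2P.
have d0 : 0 < Num.min (Num.min s s2) (r / (2 * L)).
  by rewrite !lt_min s0 s20 divr_gt0// mulr_gt0.
have : \forall q' \near q, `|chart j q - chart j q'| <
    Num.min (Num.min s s2) (r / (2 * L)).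
  by apply: cvgr_dist_lt d0; exact: chart_cvg.
apply: filterS2 (chart_dom_nbhs _ _ jq) => q' jq'.
rewrite !lt_min => /andP[/andP[ds ds2] dL] [iq' q'r].
pose w := chart j q - chart j q'.
pose y t : E := chart j q' + t *: w.
pose gam t : M := chart_inv j (y t).
pose u t : E := chart i (gam t).
have y1 : y 1 = chart j q by rewrite /y scale1r addrC subrK.
have ydist t : 0 <= t <= 1 -> `|y t - chart j q| <= `|w|.
  move=> /andP[t0 t1].
  have -> : y t - chart j q = (t - 1) *: w.
    by rewrite scalerBl scale1r /y -addrA addrCA -opprB.
  rewrite normrZ ler_piMl// distrC ger0_norm ?subr_ge0//; lra.
have yimg t : 0 <= t <= 1 -> chart_img j (y t).
  move=> tI; apply: s2P; rewrite /= distrC.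
  exact: le_lt_trans (ydist _ tI) ds2.
have gamj t : 0 <= t <= 1 -> chart_dom j (gam t).
  by move=> tI; apply: chart_inv_dom; exact: yimg.
have gam_cvg t : 0 <= t <= 1 -> {for t, continuous gam}.
  move=> tI; apply: continuous_comp; last by apply: chart_inv_cvg; exact: yimg.
  by have [/differentiable_continuous] := is_diff_line (chart j q') w t.
pose good t := chart_dom i (gam t) /\ `|u t - chart i p0| < 2 * r.
(* The bound r / (2 L) on the length of the segment makes its image shorter
   than the gap r between the two balls. *)
have KL : L * `|w| < r / 2.
  by move: dL; rewrite -/w ltr_pdivlMr ?mulr_gt0//; lra.
have u_lip a b : 0 <= a -> a <= b -> b <= 1 ->
    (forall t, a <= t <= b -> good t) -> `|u b - u a| <= L * `|w| * (b - a).
  move=> a0 ab b1 gd; apply: (curve_lipschitz E_hilbert) => // t tab.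
  have tI : 0 <= t <= 1 by move: tab => /andP[? ?]; lra.
  have [igt ur] := gd t tab.
  have yE : y t = chart j (gam t) by rewrite chart_invK//; exact: yimg.
  have dt : differentiable (chart i \o chart_inv j) (y t).
    by rewrite yE; apply: transition_differentiable => //; exact: gamj.
  have [dy dyE] := is_diff_line (chart j q') w t.
  have du : differentiable u t by exact: (differentiable_comp dy dt).
  split=> //.
  have -> : 'd u t 1 = 'd (chart i \o chart_inv j) (y t) w.
    have -> : 'd u t = 'd ((chart i \o chart_inv j) \o y) t by [].
    by rewrite (diff_comp dy dt)/= dyE scale1r.
  rewrite yE; apply: tL => //; first exact: gamj.
    exact: lt_le_trans rr1.
  rewrite -yE; exact: le_lt_trans (ydist _ tI) ds.
have gam0 : gam 0 = q'.
  by rewrite /gam /y scale0r addr0 chartK.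
have good0 : good 0.
  by rewrite /good /u gam0; split=> //; apply: le_lt_trans q'r _; lra.
have u0r : `|u 0 - chart i p0| <= r by rewrite /u gam0.
(* The endpoint t = 1 is q itself, which is not in the domain of i. *)
suff [] : good 1 by rewrite /gam y1 chartK.
apply: unit_interval_induction => //.
- move=> t /andP[t0 t1] gd.
  have lip a b : 0 <= a -> a <= b -> b < t ->
      `|u b - u a| <= L * `|w| * (b - a).
    move=> a0 ab bt; apply: u_lip => //; first exact: le_trans (ltW bt) t1.
    by move=> c /andP[ac cb]; apply: gd;
      rewrite (le_trans a0 ac) (le_lt_trans cb).
  have [l ul] := lipschitz_left_limit _ _ _ _ t0 lip.
  have lr : `|l - chart i p0| < 2 * r.
    apply: (@le_lt_trans _ _ (r + r / 2)); last by lra.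
    have ul' : `|u x - chart i p0| @[x --> t^'-] --> `|l - chart i p0|.
      by apply: cvg_norm; apply: cvgB => //; exact: cvg_cst.
    apply: (cvgr_to_le ul'); near=> x.
    have x0 : 0 < x by near: x; exact: nbhs_left_gt.
    have xt : x < t by near: x; exact: nbhs_left_lt.
    have -> : u x - chart i p0 = (u x - u 0) + (u 0 - chart i p0).
      by rewrite addrA subrK.
    apply: le_trans (ler_normD _ _) _; rewrite addrC lerD//.
    apply: le_trans (lip _ _ (lexx 0) (ltW x0) xt) _; rewrite subr0.
    have x1 : x <= 1 by apply: ltW (lt_le_trans xt t1).
    have : 0 <= L * `|w| by rewrite mulr_ge0// ltW.
    by nra.
  have tI : 0 <= t <= 1 by rewrite ltW.
  have gam_l : gam t = chart_inv i l.
    apply: (cvg_unique M_hausdorff (F := gam @ t^'-)).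
      by apply: cvg_within_filter; exact: gam_cvg.
    apply: (@cvg_trans _ ((chart_inv i \o u) @ t^'-)).
      apply: near_eq_cvg; near=> x => /=; rewrite /u chartK//.
      have x0 : 0 < x by near: x; exact: nbhs_left_gt.
      have xt : x < t by near: x; exact: nbhs_left_lt.
      by have [] := gd x _; rewrite ?xt ?ltW.
    apply: cvg_comp ul _; exact/chart_inv_cvg/img.
  split; first by rewrite gam_l; apply: chart_inv_dom; exact: img.
  by rewrite /u gam_l chart_invK//; exact: img.
- move=> t /andP[t0 t1] [igt ur].
  have tI : 0 <= t <= 1 by rewrite t0 ltW.
  have igs : \forall s \near t, chart_dom i (gam s).
    exact: gam_cvg tI _ (chart_dom_nbhs _ _ igt).
  have us : \forall s \near t, `|u s - chart i p0| < 2 * r.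
    have ucvg : u s @[s --> t] --> u t.
      apply: (@continuous_comp _ _ _ gam (chart i)); first exact: gam_cvg.
      exact: chart_cvg.
    have un : `|u s - chart i p0| @[s --> t] --> `|u t - chart i p0|.
      by apply: cvg_norm; apply: cvgB => //; exact: cvg_cst.
    exact: cvgr_lt un _ ur.
  by apply: filterS2 igs us.
Unshelve. all: by end_near. Qed.

End Regularity.

(** * Differentials and extension by zero *)

Section Differentials.
Context {R : realType} {E : normedModType R} {M : topologicalType}.
Context {A : atlas E M}.
Implicit Types (phi : M -> R) (p : M) (i j : chart_index A).

Definition coord_differential phi p i (X : tangent A p) : R :=
  'd (phi \o chart_inv i) (chart i p) (X i).

Lemma coord_differential_linear phi p i :
  linear_for *%R (coord_differential phi p i).
Proof.
move=> a X Y; rewrite /coord_differential.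
have -> : (a *: X + Y) i = a *: X i + Y i by [].
by rewrite linearP.
Qed.

HB.instance Definition _ phi p i :=
  GRing.isLinear.Build R (tangent A p) R *%R (coord_differential phi p i)
    (coord_differential_linear phi p i).

Lemma C1_differentiable phi i p : C1 A phi -> chart_dom i p ->
  differentiable (phi \o chart_inv i) (chart i p).
Proof. by move=> phi1 ip; have [+ _] := phi1 i; apply; exact: chart_imgP. Qed.

Lemma coord_differential_eq phi p i j (X : tangent A p) : C1 A phi ->
  chart_dom i p -> chart_dom j p ->
  coord_differential phi p i X = coord_differential phi p j X.
Proof.
move=> phi1 ip jp; have /asboolP[_ Xij] := valP X.
have [_ dE] := is_diff_change_chart phi i j p ip jp
  (C1_differentiable _ _ _ phi1 jp).
by rewrite /coord_differential dE /= [X j](Xij i j).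
Qed.

Lemma C1_has_differential phi p : C1 A phi ->
  exists xi : cotangent A p, is_mdiff phi xi.
Proof.
move=> phi1; have [i ip] := chart_cover A p.
have bd j : chart_dom j p ->
    exists C : R, forall X : tangent A p,
      `|coord_differential phi p i X| <= C * `|X j|.
  move=> jp; have dj := C1_differentiable _ _ _ phi1 jp.
  exists `|fderive (phi \o chart_inv j) (chart j p)| => X.
  rewrite (coord_differential_eq _ _ _ _ X phi1 ip jp) /coord_differential.
  by rewrite -(fderiveE _ _ dj); exact: blin_le_norm.
exists (@Cotangent _ _ _ A p (coord_differential phi p i) bd).
by move=> j jp X; exact: (coord_differential_eq _ _ _ _ X phi1 ip jp).
Qed.

Definition extend_by_zero i (h : E -> R) : M -> R :=
  fun q => if `[< chart_dom i q >] then h (chart i q) else 0.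

Lemma extend_by_zero_chart_inv i h y : chart_img i y ->
  extend_by_zero i h (chart_inv i y) = h y.
Proof.
move=> iy; rewrite /extend_by_zero asboolT ?chart_invK//.
exact: chart_inv_dom.
Qed.

(** Near a point outside of the chart domain the extension vanishes identically,
    thanks to the hypothesis on h; elsewhere it is h read through a transition
    map. *)
Lemma C1_extend_by_zero i (h : E -> R) : Ck 1 setT h ->
  (forall q, ~ chart_dom i q ->
    \forall q' \near q, chart_dom i q' -> h (chart i q') = 0) ->
  C1 A (extend_by_zero i h).
Proof.
move=> h1 h0 j; apply: Ck1_near_eq => x jx.
have jq := chart_inv_dom j x jx.
have [iq|niq] := pselect (chart_dom i (chart_inv j x)).
  exists (chart j @` (chart_dom j `&` chart_dom i)),
    (h \o (chart i \o chart_inv j)).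
  split.
  - exact: overlap_open.
  - by exists (chart_inv j x); rewrite ?chart_invK.
  - apply: (@Ck1_comp _ _ _ _ _ setT) => //; first exact: overlap_open.
    exact: (@transition_Cinfty _ _ _ A j i 1).
  - move=> _ [q [jq' iq'] <-] /=; rewrite !chartK// /extend_by_zero asboolT//.
have : nbhs x [set y | extend_by_zero i h (chart_inv j y) = 0].
  have : \forall y \near x, chart_dom i (chart_inv j y) ->
      h (chart i (chart_inv j y)) = 0.
    exact: chart_inv_cvg jx _ (h0 _ niq).
  apply: filterS => y yh /=.
  rewrite /extend_by_zero; case: asboolP => [iy|//]; exact: yh.
rewrite nbhsE => -[V [oV Vx] V0].
exists V, (cst 0); split=> //; last by move=> y /V0 /= h0y; rewrite /= h0y.
apply: (Ck1_is_diff _ _ (cst 0)) => //; last exact: cst_continuous.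
Qed.

End Differentials.

(** * Density of the domain of the subdifferential *)

(** Lower semicontinuity along a sequence, for real bounds that are only reached
    up to every e > 0; this is the closedness of the epigraph that the
    variational principle needs. *)
Lemma lsc_epigraph_closed {R : realType} {E : normedModType R}
  {M : topologicalType} (f : M -> \bar R) (c : E -> M) (u : E ^nat) (x : E)
  (a : R) :
  (forall y, (-oo < f y)%E) -> lower_semicontinuous f ->
  {for x, continuous c} -> u @ \oo --> x -> (forall n, (f (c (u n)) < +oo)%E) ->
  (forall e, 0 < e -> \forall n \near \oo, fine (f (c (u n))) <= a + e) ->
  (f (c x) <= a%:E)%E.
Proof.
move=> fNy flsc cx ux fu fa; rewrite leNgt; apply/negP => af.
have [e e0 aef] : exists2 e, 0 < e & ((a + e)%:E < f (c x))%E.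
  move: af (fNy (c x)); case: (f (c x)) => [v av _|_ _|_]; last by rewrite ltxx.
    exists ((v - a) / 2); first by rewrite divr_gt0// subr_gt0 -lte_fin.
    by move: av; rewrite !lte_fin; lra.
  by exists 1 => //; rewrite ltry.
have [V Vx Vf] := flsc _ _ aef.
have cu : \forall n \near \oo, V (c (u n)).
  exact: (cvg_comp _ _ ux cx) V Vx.
have [n [nV na]] := filter_ex (filterI cu (fa e e0)).
have := Vf _ nV; have : f (c (u n)) \is a fin_num.
  by rewrite fin_numElt fNy fu.
by move=> /fineK <-; rewrite lte_fin ltNge na.
Qed.

Theorem proposition4p17 (R : realType)
    (E : completeNormedModType R) (dotE : {dot E for idfun})
    (E_hilbert : forall v : E, `|v| = Num.sqrt (dotE v v))
    (M : topologicalType) (M_hausdorff : hausdorff_space M)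
    (A : atlas E M) (g : riemannian_metric A)
    (f : M -> \bar R)
    (f_gtNy : forall x, (-oo < f x)%E)
    (f_lsc : lower_semicontinuous f)
    (f_proper : exists x, f x <> +oo%E) :
  edom f `<=`
    closure [set p | edom f p /\ subdifferential A f p !=set0].
Proof.
move=> p0 fp0 W W0.
have [i ip0] := chart_cover A p0; pose x0 := chart i p0.
have [r r0 [rimg rsep]] :=
  chart_ball_separated E_hilbert M_hausdorff g i p0 ip0.
have fin p : edom f p -> f p = (fine (f p))%:E.
  by move=> fp; rewrite fineK// fin_numElt f_gtNy.
pose a := fine (f p0).
have [V V0 Vf] : exists2 V, nbhs p0 V & forall y, V y -> ((a - 1)%:E < f y)%E.
  by apply: f_lsc; rewrite fin// lte_fin gtrBl.
have x0img : chart_img i x0 := chart_imgP _ _ ip0.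
have : \forall x \near x0, (W `&` V) (chart_inv i x).
  have := chart_inv_cvg i x0 x0img; rewrite /prop_for /continuous_at chartK//.
  by apply; exact: filterI.
move=> /nbhs_ballP[r3 /= r30]; rewrite -ball_normE => r3P.
(* The closed ball of radius r4 is separated from the outside of the chart and
   mapped into W, and f is bounded below by f p0 - 1 on it. *)
pose r4 := Num.min r (r3 / 2).
have r40 : 0 < r4 by rewrite lt_min r0 divr_gt0.
have r4r : r4 <= r by rewrite ge_min lexx.
have r43 : r4 <= r3 / 2 by rewrite ge_min lexx orbT.
have ballWV x : `|x - x0| <= r4 -> (W `&` V) (chart_inv i x).
  by move=> xr; apply: r3P; rewrite /= distrC; lra.
have ballimg x : `|x - x0| <= r4 -> chart_img i x.
  by move=> xr; apply: rimg; rewrite -/x0; lra.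
pose D := [set x | `|x - x0| <= r4 /\ edom f (chart_inv i x)].
pose h x := fine (f (chart_inv i x)).
have Dx0 : D x0.
  by split; [rewrite subrr normr0 ltW|rewrite /x0 chartK].
have hx0 y : D y -> h x0 <= h y + 1.
  move=> [yr fy]; have [_ /Vf] := ballWV y yr.
  by rewrite fin// lte_fin /h /x0 chartK// -/a; lra.
have epi (u : E ^nat) x b : (forall n, D (u n)) -> u @ \oo --> x ->
    (forall e, 0 < e -> \forall n \near \oo, h (u n) <= b + e) ->
    D x /\ h x <= b.
  move=> Du ux hu.
  have xr : `|x - x0| <= r4.
    have nux : `|u n - x0| @[n --> \oo] --> `|x - x0|.
      by apply: cvg_norm; apply: cvgB => //; exact: cvg_cst.
    by apply: (cvgr_to_le nux); apply: nearW => n; have [] := Du n.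
  have fx : (f (chart_inv i x) <= b%:E)%E.
    apply: (@lsc_epigraph_closed _ _ _ f (chart_inv i) u) => //.
      exact/chart_inv_cvg/ballimg.
    by move=> n; have [] := Du n.
  have edx : edom f (chart_inv i x) by apply: le_lt_trans fx _; rewrite ltry.
  by split=> //; move: fx; rewrite fin// lee_fin.
have rho0 : 0 < r4 / 4 by rewrite divr_gt0.
have [c [w [x [c0 [xr fx] xrho xmin]]]] :=
  quadratic_variational_principle E_hilbert _ _ _ _ rho0 Dx0 hx0 epi.
(* Minus the gradient at x of the quadratic perturbation. *)
pose v := 2 *: (w - c *: x).
have hmin y : D y -> dotE v (y - x) - c * `|y - x| ^+ 2 <= h y - h x.
  move=> Dy; pose d := y - x; have yE : y = x + d by rewrite /d addrC subrK.
  have := xmin y Dy.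
  have -> : `|y| ^+ 2 = `|x| ^+ 2 + 2 * dotE x d + `|d| ^+ 2.
    by rewrite yE (normD_sqr E_hilbert).
  have -> : dotE y w = dotE x w + dotE w d by rewrite {1}yE dotDl (dotC d).
  rewrite -/d /v dotZl dotBl dotZl; lra.
(* x is within r4 / 2 of x0, and the bump is centred within s / 4 of x: its
   support, of radius s, stays in the ball of radius r4 around x0. *)
pose s := r4 / 4.
pose k := c + 1 + `|v| / s.
have s0 : 0 < s := rho0.
have vs0 : 0 <= `|v| / s by rewrite divr_ge0// ltW.
have ck : c <= k by rewrite /k; lra.
have k0 : 0 < k by rewrite /k; lra.
have vk : `|v| <= k * s.
  by rewrite -ler_pdivrMr// /k; lra.
have [cb [z [zx peak]]] := radial_bump_peak E_hilbert x v k s k0 rho0 vk.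
pose phi := extend_by_zero (A := A) i (radial_bump cb s z).
have phi1 : C1 A phi.
  apply: C1_extend_by_zero; first exact: Ck1_radial_bump E_hilbert _ _ _.
  move=> q niq; apply: filterS (rsep q niq) => q' nq' iq'.
  apply: radial_bump_support; first exact: ltW.
  rewrite leNgt; apply/negP => q'z; apply: nq'; split=> //.
  have -> : chart i q' - chart i p0 = (chart i q' - z) + (z - x) + (x - x0).
    by rewrite !addrA !subrK.
  apply: le_trans (ler_normD _ _) _.
  have := ler_normD (chart i q' - z) (z - x).
  move: xrho zx q'z; rewrite -/x0 /s; lra.
pose p := chart_inv i x.
have ximg := ballimg x xr.
have ip : chart_dom i p := chart_inv_dom _ _ ximg.
have [xi xiP] := C1_has_differential phi p phi1.
exists p; split; last by have [] := ballWV x xr.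
split; first exact: fx.
exists xi, phi; split=> //.
have near_x : \forall q \near p, `|x - chart i q| < s / 4.
  have := chart_cvg i p ip; rewrite /prop_for /continuous_at chart_invK// => cx.
  by apply: cvgr_dist_lt cx _ _; rewrite divr_gt0.
rewrite /local_min; apply: filterS2 (chart_dom_nbhs i p ip) near_x => q iq qx.
have -> : phi p = radial_bump cb s z x by exact: extend_by_zero_chart_inv.
have -> : phi q = radial_bump cb s z (chart i q).
  by rewrite /phi /extend_by_zero asboolT.
have [fq|] := ltP (f q) +oo%E; last first.
  by rewrite leye_eq => /eqP ->; rewrite addye ?leey.
rewrite (fin _ fq) fin// -!EFinB lee_fin.
have qE : q = chart_inv i (chart i q) by rewrite chartK.
have Dq : D (chart i q).
  split; last by rewrite -qE.
  have -> : chart i q - x0 = (chart i q - x) + (x - x0) by rewrite addrA subrK.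
  apply: le_trans (ler_normD _ _) _; rewrite distrC.
  move: xrho qx; rewrite /s; lra.
have xq : x + (chart i q - x) = chart i q by rewrite addrC subrK.
have qx' : `|chart i q - x| <= s / 4 by rewrite distrC ltW.
have := hmin _ Dq; have := peak _ qx'; rewrite xq /h -qE.
have : c * `|chart i q - x| ^+ 2 <= k * `|chart i q - x| ^+ 2.
  by rewrite ler_wpM2r ?sqr_ge0.
rewrite -/p; lra.
Qed.
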